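(* Let $m\ge 1$ and $k\ge 1$ be integers, let $H$ be a strongly sequenceable finite abelian group, and let $\varphi:H\to\mathrm{Aut}(\mathbb{Z}_m)$ be a group homomorphism satisfying property $( * )$: for every $h\in H$, $\varphi(h)$ is either the identity or the map $x\mapsto -x$. If every prime factor of $m$ is greater than $k!$, then any subset $S$ of size $k$ of $(\mathbb{Z}_m\rtimes_{\varphi} H)\setminus\{0\}$ is sequenceable.
   Context: Groups are written additively even when they are not abelian, and $0$ denotes the identity element. The group $\mathbb{Z}_m\rtimes_\varphi H$ is the set $\mathbb{Z}_m\times H$ with operation $(x,h)+(y,g)=(x+\varphi(h)(y),\ h+g)$. A finite subset $S$ of size $k$ of a group is sequenceable if there is an ordering $(x_1,\dots,x_k)$ of its elements such that the partial sums $(s_0,s_1,\dots,s_k)$, given by $s_0=0$ and $s_i=x_1+x_2+\dots+x_i$ (summed in this order) for $1\le i\le k$, are pairwise distinct, with the possible exception that $s_k=s_0=0$ is allowed. A group is strongly sequenceable if every (finite) subset of it not containing $0$ is sequenceable. *)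

(* Defs.v *)
From HB Require Import structures.
From mathcomp Require Import all_boot all_order all_algebra all_fingroup.

Set Implicit Arguments.
Unset Strict Implicit.
Unset Printing Implicit Defensive.

Import GroupScope.

(* MathComp's groups are multiplicative: 1 and x * y below are the 0 and x + y
   of the additive notation. *)

Section Sequenceable.
Variable gT : finGroupType.

(* s_i = x_1 + ... + x_i, in this order; in particular s_0 is the identity. *)
Definition psum (s : seq gT) (i : nat) : gT := \prod_(x <- take i s) x.

(* If s_i = s_j with i < j, the only possibility is s_k = s_0. *)
Definition sequencing (s : seq gT) : Prop :=
  forall i j : nat, (i < j)%N -> (j <= size s)%N ->
    psum s i = psum s j -> i = 0%N /\ j = size s.

Definition sequenceable (S : {set gT}) : Prop :=
  exists s : seq gT, perm_eq s (enum S) /\ sequencing s.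

End Sequenceable.

Definition strongly_sequenceable (gT : finGroupType) : Prop :=
  forall S : {set gT}, 1 \notin S -> sequenceable S.

(* Homomorphisms H -> Aut(K), with the composition of functions as the group
   law of Aut(K).  Since (s * t) x = t (s x) for s t : {perm K}, this is
   not {morphism [set: H] >-> {perm K}} unless H is abelian. *)
Record aut_hom (H K : finGroupType) := AutHom {
  aut_hom_fun :> H -> {perm K};
  aut_homP : forall h, aut_hom_fun h \in Aut [set: K];
  aut_homM : forall h g x,
    aut_hom_fun (h * g) x = aut_hom_fun h (aut_hom_fun g x)
}.

(* MathComp's sdprod_by uses right actions and another formula for the product,
   namely (a, x) * (b, y) = (a * b, to x b * y). *)
Section SemidirectProduct.
Variables H K : finGroupType.

Record semidirect (phi : aut_hom H K) : predArgType :=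
  Semidirect { sdval : K * H }.

Variable phi : aut_hom H K.

HB.instance Definition _ := [isNew for @sdval phi].
HB.instance Definition _ := [Finite of semidirect phi by <:].

Definition sd_one : semidirect phi := Semidirect phi (1, 1).

Definition sd_mul (u v : semidirect phi) : semidirect phi :=
  let: (x, h) := sdval u in let: (y, g) := sdval v in
  Semidirect phi (x * phi h y, h * g).

Definition sd_inv (u : semidirect phi) : semidirect phi :=
  let: (x, h) := sdval u in Semidirect phi (phi h^-1 x^-1, h^-1).

Lemma aut_hom1 x : phi 1 x = x.
Proof. by apply: (@perm_inj _ (phi 1)); rewrite -aut_homM mulg1. Qed.

Lemma aut_hom_morph h : {morph phi h : x y / x * y}.
Proof.
move=> x y; have := aut_homP phi h; rewrite inE => /andP[_ /morphicP].
by apply; rewrite inE.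
Qed.

Lemma sd_mulA : associative sd_mul.
Proof.
move=> [[x h]] [[y g]] [[z f]]; rewrite /sd_mul /=.
by rewrite aut_hom_morph aut_homM !mulgA.
Qed.

Lemma sd_mul1 : left_id sd_one sd_mul.
Proof. by move=> [[x h]]; rewrite /sd_mul /= aut_hom1 !mul1g. Qed.

Lemma sd_mulV : left_inverse sd_one sd_inv sd_mul.
Proof.
move=> [[x h]]; rewrite /sd_mul /= -aut_hom_morph !mulVg.
congr (Semidirect phi (_, _)).
by apply: (mulgI (phi h^-1 1)); rewrite -aut_hom_morph !mulg1.
Qed.

HB.instance Definition _ :=
  Finite_isGroup.Build (semidirect phi) sd_mulA sd_mul1 sd_mulV.

End SemidirectProduct.

(* The additive group Z/m for every m >= 1; 'Z_m would be Z/2 when m = 1. *)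
Notation Zmod m := 'I_m.-1.+1 (only parsing).

Definition id_or_opp (m : nat) (H : finGroupType)
    (phi : aut_hom H (Zmod m)) : Prop :=
  forall h : H, (forall x : Zmod m, phi h x = x) \/
                (forall x : Zmod m, phi h x = (- x)%R).

(* Main.v *)
Require Import Defs.
From mathcomp Require Import all_boot all_order all_algebra all_fingroup.
From mathcomp Require Import zify.

(** Two partial sums coincide exactly when the block of consecutive terms
    between them sums to the identity, so an ordering is wanted in which no
    nonempty block other than the whole list does.  Write a term as (x, g) and
    call it a reflection if g acts by negation, a translation otherwise.  The
    first coordinate of a block sum is a signed sum of the x's, where the sign
    flips after each reflection ([walk], [sd_prodE]); the second is a sum in H.

    Replacing residues by rationals.  The signed sums are linear forms with
    coefficients -1, 0, 1.  Among these forms, let those that vanish modulo m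
    span a rational space W.  A form in W is, by Cramer's rule, a combination of
    vanishing ones with a common denominator equal to a minor of a matrix with
    entries -1, 0, 1; such a minor is at most k! in absolute value, hence
    coprime to m, and so the form itself vanishes modulo m.  A generic rational
    point annihilated by W therefore kills exactly the same forms as the given
    residues ([rational_model], [rational_walk_model]).  From here on the first
    coordinates live in an ordered group.

    If there are reflections ([reflections_sequence]), subtract from the first
    coordinate of every reflection the median c of these coordinates.  A block
    whose H-sum is trivial has an even number of reflections, with alternating
    signs, so its signed sum is unchanged.  Now every term with a nonzero
    coordinate can be put at a place where the current sign makes its
    contribution positive: translations wait for the right sign, and the median
    guarantees that the positive and the negative reflections can alternate,
    with reflections of coordinate 0 as wildcards ([alternating_merge]).  The
    partial sums are then nondecreasing, so a vanishing block consists of terms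
    of coordinate 0.  Those have distinct, nontrivial H-parts and are kept in an
    order provided by the strong sequenceability of H; hence a vanishing block
    is all of them, and this is prevented by a nonzero term put among them
    ([balanced_reflections_sequence]).

    If there are only translations ([translations_sequence]), the order is:
    positive terms, terms of coordinate 0, negative terms.  A dangerous block
    joins a suffix of the positive terms to a prefix of the negative ones.  A
    good order is found from the outside in: if the total coordinate is
    nonnegative, the outermost positive term is chosen so that the remaining
    terms do not sum to zero, which excludes at most one candidate
    ([uncrossed_orders]).  If the whole list sums to zero, or the terms of
    coordinate 0 do, one term is put in front of everything else; blocks that
    start there have positive coordinate unless they consist of this term alone
    or exhaust the list ([prepend_no_proper_block]). *)

Set Implicit Arguments.
Unset Strict Implicit.
Unset Printing Implicit Defensive.

Import Order.TTheory GRing.Theory Num.Theory.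
Local Open Scope ring_scope.

(** * Rational models of residues *)

Lemma det_norm_le_fact (r : nat) (A : 'M[int]_r) :
  (forall i j, `|A i j| <= 1) -> `|\det A| <= (r`!)%:Z.
Proof.
move=> A1; apply: le_trans (ler_norm_sum _ _ _) _.
rewrite -[X in _ <= X]mulr1 -[in X in _ <= X]card_Sn -natz mulr_natl.
rewrite -sumr_const; apply: ler_sum => s _.
rewrite normrM normr_sign mul1r normr_prod.
by apply: prodr_ile1 => i _; rewrite normr_ge0 A1.
Qed.

(** Cramer's rule on a maximal nonsingular submatrix D of B expresses
    [\det D *: e] as an integral combination of rows of B.  As [\det D] is a
    nonzero integer of absolute value at most k!, it is invertible modulo m. *)
Lemma dvdz_rat_span (m N k : nat) (B : 'M[int]_(N, k)) (e : 'rV[int]_k)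
    (x : 'cV[int]_k) :
  (0 < m)%N -> (forall p : nat, prime p -> (p %| m)%N -> (k`! < p)%N) ->
  (forall i j, `|B i j| <= 1) ->
  (map_mx (intr : int -> rat) e <= map_mx intr B)%MS ->
  (forall i, (m %| (B *m x) i ord0)%Z) -> (m %| (e *m x) ord0 ord0)%Z.
Proof.
move=> m0 mP B1 eB Bx.
pose BQ := map_mx (intr : int -> rat) B.
pose f := maxrankfun BQ; pose B' := rowsub f B.
have fB' : row_free (map_mx (intr : int -> rat) B').
  by rewrite map_mxsub maxrowsub_free.
have fullT : row_full (map_mx (intr : int -> rat) B')^T.
  by rewrite /row_full mxrank_tr.
pose g := fullrankfun fullT; pose D := colsub g B'.
have detD : \det D != 0.
  have := fullrowsub_unit fullT; rewrite -/g unitmxE unitfE.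
  rewrite -trmx_mxsub det_tr -map_mxsub det_map_mx.
  by rewrite intr_eq0.
have key : \det D *: e = colsub g e *m \adj D *m B'.
  have inj_intr : injective (map_mx (intr : int -> rat) : 'M_(1, k) -> _).
    by move=> u w uw; apply/matrixP => i j; move/matrixP/(_ i j): uw;
      rewrite !mxE; apply: intr_inj.
  apply: inj_intr.
  have /submxP[c ec] : (map_mx (intr : int -> rat) e <= map_mx intr B')%MS.
    by rewrite map_mxsub eq_maxrowsub.
  have eD :
    map_mx (intr : int -> rat) (colsub g e) =
      c *m map_mx (intr : int -> rat) D.
    by rewrite map_mxsub ec -mulmx_colsub -map_mxsub.
  rewrite map_mxZ !map_mxM map_mx_adj eD -(mulmxA c) mul_mx_adj.
  by rewrite det_map_mx mul_mx_scalar ec scalemxAl.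
have cop : coprimez m (\det D).
  rewrite /coprimez /gcdz /=; apply/eqP; congr Posz; apply/eqP.
  rewrite -/(coprime _ _); apply: contraT => ncop.
  have g1 : (1 < gcdn m `|\det D|)%N.
    have: (0 < gcdn m `|\det D|)%N by rewrite gcdn_gt0 m0.
    by move: ncop; rewrite /coprime; case: (gcdn _ _) => [|[|]].
  have [p pp pg] := pdivP g1.
  have pm := dvdn_trans pg (dvdn_gcdl _ _).
  have pd := dvdn_trans pg (dvdn_gcdr _ _).
  have := mP p pp pm; rewrite ltnNge => /negP[].
  have pD : (p <= `|\det D|)%N by apply: dvdn_leq => //; rewrite absz_gt0.
  apply: leq_trans pD _; rewrite -lez_nat abszE.
  apply: le_trans (det_norm_le_fact _) _.
    by move=> i j; rewrite !mxE.
  by rewrite lez_nat; apply: leq_fact; apply: rank_leq_col.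
rewrite -(Gauss_dvdzr _ cop).
have -> : \det D * (e *m x) ord0 ord0 =
    ((colsub g e *m \adj D) *m (B' *m x)) ord0 ord0.
  by rewrite mulmxA -key -scalemxAl [in RHS]mxE.
rewrite mxE; apply: rpred_sum => i _; apply: dvdz_mull.
suff -> : (B' *m x) i ord0 = (B *m x) (f i) ord0 by exact: Bx.
by rewrite !mxE; apply: eq_bigr => j _; rewrite mxE.
Qed.

Lemma rat_nonroot (p : {poly rat}) : p != 0 -> exists t : rat, p.[t] != 0.
Proof.
move=> p0.
pose s := [seq (i%:R : rat) | i <- iota 0 (size p)].
have us : uniq s.
  rewrite map_inj_uniq ?iota_uniq // => i j /eqP.
  by rewrite eqr_nat => /eqP.
case: (boolP (all (root p) s)) => [sr|/allPn[t _ pt]]; last by exists t.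
by have := max_poly_roots p0 sr us; rewrite size_map size_iota ltnn.
Qed.

(** The point y is found in two steps.  The cokernel C of the matrix of
    vanishing forms maps a form to 0 exactly when the form is in their span;
    then the rational vector obtained is turned into a number by reading it as
    a polynomial and evaluating at a common non-root t of the finitely many
    nonzero polynomials that occur. *)
Lemma rational_model_ord (m k : nat) (x : 'I_k -> int) :
  (0 < m)%N -> (forall p : nat, prime p -> (p %| m)%N -> (k`! < p)%N) ->
  exists y : 'I_k -> rat, forall e : 'I_k -> int, (forall i, `|e i| <= 1) ->
    (m %| \sum_i e i * x i)%Z = (\sum_i (e i)%:~R * y i == 0).
Proof.
move=> m0 mP.
pose X : 'cV[int]_k := \col_i x i.
pose F := {ffun 'I_k -> 'I_3}.
(* A finite type of forms: coefficients in {0, 1, 2}, shifted by one. *)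
pose sv (e : F) : 'rV[int]_k := \row_i ((e i)%:Z - 1).
have sv1 e i j : `|sv e i j| <= 1 by rewrite mxE; case: (e j) => [[|[|[|]]]].
pose B : 'M[int]_(#|F|, k) := \matrix_(a, i)
  if (m %| (sv (enum_val a) *m X) ord0 ord0)%Z then sv (enum_val a) ord0 i
  else 0.
pose C := cokermx (map_mx (intr : int -> rat) B).
pose v e := map_mx (intr : int -> rat) (sv e) *m C.
pose Q := \prod_(e | v e != 0) rVpoly (v e).
have Q0 : Q != 0.
  apply/prodf_neq0 => e; apply: contra => /eqP e0.
  by rewrite -[v e]rVpolyK e0 linear0.
have [t Qt] := rat_nonroot Q0.
exists (fun i => (rVpoly (row i C)).[t]) => e e1.
pose e' : F := [ffun i => inord (absz (e i + 1)%R)].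
have ee' i : e i = sv e' ord0 i.
  rewrite mxE ffunE inordK; last by have := e1 i; lia.
  by have := e1 i; lia.
have -> : \sum_i e i * x i = (sv e' *m X) ord0 ord0.
  by rewrite mxE; apply: eq_bigr => i _; rewrite ee' [X _ _]mxE.
have -> : \sum_i (e i)%:~R * (rVpoly (row i C)).[t] = (rVpoly (v e')).[t].
  rewrite /v mulmx_sum_row linear_sum horner_sum; apply: eq_bigr => i _.
  by rewrite linearZ /= hornerZ ee' [in RHS]mxE.
have -> : ((rVpoly (v e')).[t] == 0) = (v e' == 0).
  apply/idP/eqP => [|->]; last by rewrite linear0 horner0.
  move=> vt; apply/eqP; move: Qt; rewrite /Q horner_prod.
  apply: contraNT => v0; apply/prodf_eq0; exists e' => //.
rewrite /v -submxE; apply/idP/idP => [dv|].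
  suff -> : sv e' = row (enum_rank e') B by rewrite map_row row_sub.
  by apply/rowP => i; rewrite [in RHS]mxE [in RHS]mxE enum_rankK dv.
move=> sB; apply: (dvdz_rat_span m0 mP _ sB) => [i j|i].
  rewrite [B _ _]mxE; case: ifP => _; last by rewrite normr0.
  exact: sv1.
have -> : (B *m X) i ord0 = if (m %| (sv (enum_val i) *m X) ord0 ord0)%Z
    then (sv (enum_val i) *m X) ord0 ord0 else 0.
  case: ifPn => dv.
    rewrite !mxE; apply: eq_bigr => j _; congr (_ * _).
    by rewrite mxE dv.
  rewrite mxE big1 // => j _; rewrite [B _ _]mxE (negPf dv) mul0r //.
by case: ifP => // _; apply: dvdz0.
Qed.

Lemma rational_model (T : finType) (S : {set T}) (m : nat) (x : T -> int) :
  (0 < m)%N -> (forall p : nat, prime p -> (p %| m)%N -> (#|S|`! < p)%N) ->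
  exists y : T -> rat, forall e : T -> int, (forall u, `|e u| <= 1) ->
    (m %| \sum_(u in S) e u * x u)%Z = (\sum_(u in S) (e u)%:~R * y u == 0).
Proof.
move=> m0 mP.
have [y yP] := rational_model_ord (fun i : 'I_#|S| => x (enum_val i)) m0 mP.
have [S0|[u0 Su0]] := set_0Vmem S.
  by exists (fun=> 0) => e _; rewrite S0 !big_set0 dvdz0 eqxx.
exists (fun u => y (enum_rank_in Su0 u)) => e e1.
rewrite [in LHS]big_enum_val [in RHS]big_enum_val.
rewrite (yP (fun i => e (enum_val i)) (fun i => e1 _)).
congr (_ == _); apply: eq_bigr => i _; congr (_ * _).
by rewrite enum_valK_in.
Qed.

(** * Orderings without trivial blocks *)

Section Blocks.
Variables (T : Type) (Z : seq T -> Prop).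

Definition no_block (s : seq T) :=
  forall a b c, s = a ++ b ++ c -> b <> [::] -> ~ Z b.

Definition no_proper_block (s : seq T) :=
  forall a b c, s = a ++ b ++ c -> b <> [::] -> Z b -> a = [::] /\ c = [::].

Lemma cat_overlap (a b c d : seq T) : a ++ b = c ++ d ->
  exists e, (c = a ++ e /\ b = e ++ d) \/ (a = c ++ e /\ d = e ++ b).
Proof.
elim: a c => [|x a IHa] [|y c] /=.
- by move=> ->; exists [::]; left.
- by move=> ->; exists (y :: c); left.
- by move=> <-; exists (x :: a); right.
- case=> -> /IHa[e [[-> ->]|[-> ->]]]; exists e; [by left | by right].
Qed.

Lemma no_block_proper s : no_block s -> no_proper_block s.
Proof. by move=> sP a b c es b0 /(sP _ _ _ es b0). Qed.

Lemma no_proper_block_nonzero s : no_proper_block s -> ~ Z s -> no_block s.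
Proof.
move=> sP nZ a b c es b0 Zb; have [a0 c0] := sP a b c es b0 Zb.
by apply: nZ; rewrite es a0 c0 cats0.
Qed.

Lemma no_block_cat s1 s2 : no_block s1 -> no_block s2 ->
  (forall a p q c, s1 = a ++ p -> s2 = q ++ c -> p <> [::] -> q <> [::] ->
     ~ Z (p ++ q)) ->
  no_block (s1 ++ s2).
Proof.
move=> P1 P2 P12 a b c /cat_overlap[e [[_ e2]|[e1 /esym]]]; first exact: P2 e2.
move=> /esym/cat_overlap[f [[ee _]|[eb e2]]].
  by apply: (P1 a b f); rewrite e1 ee.
case: e e1 eb => [|x e] e1 eb; first by apply: (P2 [::] b c); rewrite /= eb.
case: f eb e2 => [|y f] eb e2 b0.
  by apply: (P1 a b [::]) => //; rewrite eb !cats0.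
by rewrite eb; apply: (P12 _ _ _ _ e1 e2).
Qed.

(** Only blocks that start at the new head are to be checked, and the one that
    exhausts the list is exempt. *)
Lemma no_proper_block_cons x s : no_block s ->
  (forall q c, s = q ++ c -> c <> [::] -> ~ Z (x :: q)) ->
  no_proper_block (x :: s).
Proof.
move=> sP xP [|y a] b c /=; last by case=> _ es b0 /(sP _ _ _ es b0).
case: b => // y q [<- es] _ Zq; split => //.
by case: c es => // z c es; case: (xP q (z :: c)).
Qed.

End Blocks.

(** Equal partial sums at i < j mean that the block of terms i + 1, ..., j is
    trivial, and conversely. *)
Lemma no_proper_blockP (gT : finGroupType) (s : seq gT) :
  sequencing s <-> no_proper_block (fun b => \prod_(x <- b) x = 1)%g s.
Proof.
split=> sP.
  move=> a b c es b0 Zb.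
  have b1 : (0 < size b)%N by case: (b) b0.
  have [|||i0 j0] := sP (size a) (size a + size b)%N.
  - by rewrite -addn1 leq_add2l.
  - by rewrite es !size_cat addnA leq_addr.
  - rewrite /psum es take_size_cat // -size_cat catA take_size_cat //.
    by rewrite big_cat /= Zb mulg1.
  - have /eqP := j0; rewrite es !size_cat eqn_add2l.
    rewrite -[X in X == _]addn0 eqn_add2l eq_sym => /eqP/size0nil c0.
    by split=> //; apply: size0nil.
move=> i j ij js eij.
have ej : take j s = take i s ++ take (j - i) (drop i s).
  by rewrite -takeD subnKC // ltnW.
have es : s = take i s ++ take (j - i) (drop i s) ++ drop j s.
  by rewrite catA -ej cat_take_drop.
have [||a0 c0] := sP _ _ _ es.
- move=> /(congr1 size); rewrite size_take_min size_drop /=; lia.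
- by apply: (mulgI (psum s i)); rewrite mulg1 [RHS]eij /psum ej big_cat.
- move: (congr1 size a0) (congr1 size c0).
  by rewrite size_take_min size_drop /=; lia.
Qed.

Lemma strongly_sequenceable_seq (T : eqType) (H : finGroupType) (h : T -> H)
    (K : seq T) :
  strongly_sequenceable H -> uniq K -> {in K &, injective h} ->
  (forall u, u \in K -> h u != 1%g) ->
  exists2 kap, perm_eq kap K &
    no_proper_block (fun b => \prod_(u <- b) h u = 1)%g kap.
Proof.
move=> sH uK hK h1.
have [|s [ps]] := sH [set x in map h K].
  by rewrite inE; apply/mapP => -[u /h1 + e1]; rewrite -e1 eqxx.
have {}ps : perm_eq s (map h K).
  apply: perm_trans ps _; apply: uniq_perm.
  - exact: enum_uniq.
  - by rewrite map_inj_in_uniq.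
  - by move=> x; rewrite mem_enum inE.
case: K uK hK h1 ps => [|u0 K'] uK hK h1 ps.
  exists [::] => //; case=> [|//] [|//] c; by [].
move: (u0 :: K') uK hK h1 ps => {}K uK hK h1 ps.
have [Is pI es] := perm_iotaP (h u0) ps.
have eK : s = map h (map (nth u0 K) Is).
  rewrite es -map_comp; apply/eq_in_map => i; rewrite (perm_mem pI) mem_iota.
  by rewrite size_map => /= iK; rewrite (nth_map u0).
move=> /no_proper_blockP sP; exists (map (nth u0 K) Is).
  rewrite -[X in perm_eq _ X](mkseq_nth u0) /mkseq.
  by rewrite perm_map // -(size_map h).
move=> a b c ek b0 Zb.
have [||| a0 c0] := sP (map h a) (map h b) (map h c).
- by rewrite eK ek !map_cat.
- by case: (b) b0.
- by rewrite big_map.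
- by case: (a) (c) a0 c0 => [|? ?] [|? ?].
Qed.

(** * Signed sums and monotone walks *)

Lemma sub_no_proper_block (T : Type) (Z Z' : seq T -> Prop) s :
  (forall b, Z b -> Z' b) -> no_proper_block Z' s -> no_proper_block Z s.
Proof. by move=> ZZ' sP a b c es b0 /ZZ'; apply: sP es b0. Qed.

(** The signed sum of the values along s: [r] marks the reflections, and [b]
    tells whether the current sign is negative. *)
Fixpoint walk (T : Type) (V : zmodType) (y : T -> V) (r : pred T) (b : bool)
    (s : seq T) : V :=
  if s is u :: s' then (if b then - y u else y u) + walk y r (b (+) r u) s'
  else 0.

Definition zero_block (T : Type) (V : zmodType) (H : finGroupType)
    (h : T -> H) (y : T -> V) (r : pred T) (s : seq T) :=
  (\prod_(u <- s) h u = 1)%g /\ walk y r false s = 0.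

Section Walk.
Variables (T : Type) (V : zmodType) (r : pred T).
Implicit Types (y : T -> V) (s : seq T).

Lemma walk_negb y b s : walk y r (~~ b) s = - walk y r b s.
Proof.
elim: s b => [|u s IH] b /=; first by rewrite oppr0.
by rewrite addNb IH opprD; case: b; rewrite /= ?opprK.
Qed.

Lemma walk_opp y b s : walk (fun u => - y u) r b s = - walk y r b s.
Proof.
elim: s b => [|u s IH] b /=; first by rewrite oppr0.
by rewrite IH opprD; case: b; rewrite /= ?opprK.
Qed.

Definition recenter y (c : V) (u : T) := if r u then y u - c else y u.

(** The corrections have alternating signs, so they cancel over an even number
    of reflections.  In the group, recentering is conjugation by a translation
    of length c/2. *)
Lemma walk_recenter y c b s :
  walk (recenter y c) r b s =
  walk y r b s - (if odd (count r s) then if b then - c else c else 0).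
Proof.
elim: s b => [|u s IH] b /=; first by rewrite subr0.
rewrite IH /recenter oddD oddb; case: (r u); rewrite ?addbT ?addbF ?addTb //=.
  have -> : (if b then - (y u - c) else y u - c) =
      (if b then - y u else y u) - (if b then - c else c).
    by case: (b); rewrite ?opprB ?opprK // addrC.
  rewrite addrACA -opprD; congr (_ + _ - _).
  by case: (b) (odd _) => [] [] /=; rewrite ?addNr ?subrr ?addr0.
by rewrite addrA.
Qed.

End Walk.

Section Monotone.
Variables (T : eqType) (R : realDomainType) (y : T -> R) (r : pred T).
Implicit Types (s : seq T).

Fixpoint monotone (b : bool) (s : seq T) : bool :=
  if s is u :: s' then
    (if b then y u <= 0 else 0 <= y u) && monotone (b (+) r u) s'
  else true.

Lemma monotone_cat b s1 s2 :
  monotone b (s1 ++ s2) =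
  monotone b s1 && monotone (b (+) odd (count r s1)) s2.
Proof.
elim: s1 b => [|u s1 IH] b /=; first by rewrite addbF.
by rewrite IH andbA oddD oddb addbA.
Qed.

Lemma monotone_walk_ge0 b s : monotone b s -> 0 <= walk y r b s.
Proof.
elim: s b => [|u s IH] b //= /andP[yu /IH ws]; apply: addr_ge0 => //.
by case: b yu {IH ws}; rewrite ?oppr_ge0.
Qed.

Lemma monotone_walk_eq0 b s :
  monotone b s -> walk y r b s = 0 -> all (fun u => y u == 0) s.
Proof.
elim: s b => [|u s IH] b //= /andP[yu ms] /eqP.
rewrite paddr_eq0 ?monotone_walk_ge0 //; last first.
  by case: b yu {ms}; rewrite ?oppr_ge0.
move=> /andP[yu0 /eqP ws]; rewrite (IH _ ms ws) andbT.
by case: b yu0 {yu ms ws}; rewrite ?oppr_eq0.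
Qed.

(** The walk along an inner block, restarted with positive sign, is up to a
    global sign the contribution of the block to the whole walk. *)
Lemma monotone_block_eq0 b0 a b c : monotone b0 (a ++ b ++ c) ->
  walk y r false b = 0 -> all (fun u => y u == 0) b.
Proof.
rewrite !monotone_cat => /and3P[_ mb _] wb.
apply: monotone_walk_eq0 mb _; case: (_ (+) _) => //.
by rewrite -[true]/(~~ false) walk_negb wb oppr0.
Qed.

Lemma monotone_level b s :
  all (fun u => ~~ r u && (if b then y u <= 0 else 0 <= y u)) s ->
  monotone b s /\ count r s = 0%N.
Proof.
elim: s => //= u s IH /andP[/andP[ru yu] /IH[ms cs]].
by rewrite yu (negPf ru) addbF ms cs.
Qed.

(** At level b a reflection in A can be used, and one in O at the opposite
    level; the terms of K fit everywhere, and the reflections among them absorb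
    the imbalance between A and O.  Terms of A are used as early as possible, so
    that the result starts with a nonzero term if it can. *)
Lemma alternating_merge b (A O K : seq T) :
  all (fun u => r u && (if b then y u < 0 else 0 < y u)) A ->
  all (fun u => r u && (if b then 0 < y u else y u < 0)) O ->
  all (fun u => y u == 0) K ->
  (size A <= size O + count r K + 1)%N -> (size O <= size A + count r K)%N ->
  exists M, [/\ perm_eq M (A ++ O ++ K), monotone b M,
    [seq u <- M | y u == 0] = K &
    A = [::] \/ exists v M', M = v :: M' /\ y v != 0].
Proof.
have [n] := ubnP (size A + size O + size K)%N.
elim: n b A O K => // n IH b [|x A] O K.
- case: K => [|k K] szn _ allO; rewrite /=.
    rewrite addn0 leqn0 => _ _ /eqP/size0nil ->.
    by exists [::]; split=> //; left.
  move=> /andP[k0 allK] szA szO; case: (boolP (r k)) => rk.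
    have [|//|//|||M [pM mM fM _]] := IH (~~ b) O [::] K _ _ _ allK.
    + by move: szn => /=; lia.
    + by case: b {szA szO} allO.
    + by move: szO; rewrite rk /=; lia.
    + by move: szO; rewrite rk /=; lia.
    exists (k :: M); split=> /=.
    + by rewrite perm_sym perm_catC /= perm_cons perm_catC perm_sym.
    + by rewrite rk addbT mM (eqP k0) lexx; case: (b).
    + by rewrite k0 fM.
    + by left.
  have [|//|||M [pM mM fM _]] := IH b [::] O K _ _ allO allK.
  + by move: szn => /=; lia.
  + by [].
  + by move: szO; rewrite (negPf rk).
  exists (k :: M); split=> /=.
  + by rewrite perm_sym perm_catC /= perm_cons perm_catC perm_sym.
  + by rewrite (negPf rk) addbF mM (eqP k0) lexx; case: (b).
  + by rewrite k0 fM.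
  + by left.
move=> szn /= /andP[/andP[rx yx] allA] allO allK szA szO.
have [|||//|||M [pM mM fM _]] := IH (~~ b) O A K.
+ by move: szn => /=; lia.
+ by case: b {yx} allO allA.
+ by case: b {yx} allO allA.
+ by lia.
+ by lia.
have yx0 : y x != 0.
  by case: b yx {allA allO mM}; [move/ltr0_neq0 | move/lt0r_neq0].
exists (x :: M); split=> /=.
+ by rewrite perm_cons; apply: perm_trans pM _; rewrite perm_catCA.
+ by rewrite rx addbT mM andbT; case: (b) yx => /ltW.
+ by rewrite (negPf yx0).
+ by right; exists x, M.
Qed.

End Monotone.

(** * Sequencing sets that contain reflections *)

Lemma count_by_sign (T : Type) (R : realDomainType) (y : T -> R) (r q : pred T)
    (S : seq T) :
  count q S =
  (count (predI q [pred u | ~~ r u & (0 < y u)%R]) S +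
   count (predI q [pred u | ~~ r u & (y u < 0)%R]) S +
   count (predI q [pred u | r u & (y u < 0)%R]) S +
   count (predI q [pred u | r u & (0 < y u)%R]) S +
   count (predI q [pred u | (y u == 0)%R]) S)%N.
Proof.
elim: S => //= u S ->.
move: (count _ S) (count _ S) (count _ S) (count _ S) (count _ S).
by case: (ltgtP (y u)) (q u) (r u) => _ [] [] /=; clear; lia.
Qed.

Lemma separated_not_contiguous (T : Type) (q : pred T) t1 v t2 a b c :
  t1 ++ v :: t2 = a ++ b ++ c -> b <> [::] -> all q b -> ~~ q v ->
  has q t1 -> has q t2 -> has q a || has q c.
Proof.
move=> /cat_overlap[e [[-> _]|[-> /esym/cat_overlap[f [[-> e2]|[_ ->]]]]]].
- by move=> _ _ _ qt1 _; rewrite has_cat qt1.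
- case: f e2 => [|w f] /= e2.
    by rewrite -e2 /= => _ _ _ _ ->; rewrite !orbT.
  by case: e2 => -> _ _; rewrite all_cat /= => /and3P[_ ->].
- by move=> _ _ _ _ qt2; rewrite !has_cat /= qt2 !orbT.
Qed.

(** The order is: positive translations, the terms of coordinate 0 up to and
    including the first reflection kj among them, negative translations, and
    then an alternating merge of all the rest.  If the block of all terms of
    coordinate 0 has trivial H-sum, it contains another reflection after kj; so
    a negative term, if there is one, separates it.  This is why a negative term
    is required to exist as soon as there is a positive one. *)
Lemma balanced_reflections_sequence (T : eqType) (R : realDomainType)
    (H : finGroupType) (h : T -> H) (y : T -> R) (r : pred T) (S : seq T) :
  strongly_sequenceable H ->
  (forall s, \prod_(u <- s) h u = 1 -> ~~ odd (count r s))%g ->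
  uniq S -> {in S &, forall u v, y u = y v -> h u = h v -> u = v} ->
  {in S, forall u, y u = 0 -> h u != 1%g} ->
  let P := [seq u <- S | r u & 0 < y u] in
  let N := [seq u <- S | r u & y u < 0] in
  let C := [seq u <- S | r u & y u == 0] in
  C != [::] -> (size P < size N + size C)%N -> (size N <= size P + size C)%N ->
  has (fun u => y u < 0) S || all (fun u => y u <= 0) S ->
  exists2 t, perm_eq t S & no_proper_block (zero_block h y r) t.
Proof.
move=> sH hr uS injS S1 P N C C0 sP sN hasN.
pose zero := [pred u | y u == 0].
pose K := [seq u <- S | zero u].
have [||kap pk kapP] :=
  @strongly_sequenceable_seq _ _ h K sH (filter_uniq _ uS).
- move=> u v; rewrite !mem_filter => /andP[/eqP yu uS'] /andP[/eqP yv vS].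
  by apply: injS => //; rewrite yu yv.
- by move=> u; rewrite mem_filter => /andP[/eqP yu uS']; apply: S1.
have sC : size C = count r kap.
  by rewrite (seq.permP pk) count_filter size_filter.
have hr_kap : has r kap by rewrite has_count -sC lt0n size_eq0.
have [k1 [kj [k2 [ek k1r kjr]]]] : exists k1 kj k2,
    [/\ kap = k1 ++ kj :: k2, all (fun u => ~~ r u) k1 & r kj].
  case/split_find: hr_kap => kj k1 k2 rk nk.
  by exists k1, kj, k2; rewrite cat_rcons all_predC.
have zk : all zero kap by rewrite (perm_all _ pk) filter_all.
move: (zk); rewrite ek all_cat /= => /and3P[zk1 zkj zk2].
pose PT := [seq u <- S | ~~ r u & 0 < y u].
pose NT := [seq u <- S | ~~ r u & y u < 0].
have ck1 : count r k1 = 0%N.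
  by apply/eqP; rewrite -leqn0 leqNgt -has_count -all_predC.
have rk2 : count r kap = (count r k2).+1.
  by rewrite ek count_cat ck1 /= kjr.
have [||||M [pM mM fM headM]] :=
    @alternating_merge _ _ y r true N P k2 _ _ zk2.
- exact: filter_all.
- exact: filter_all.
- by rewrite -addnA addn1 -rk2 -sC.
- by move: sP; rewrite sC rk2 addnS ltnS.
pose t := (PT ++ k1 ++ [:: kj]) ++ NT ++ M.
have fPT : [seq u <- PT | zero u] = [::].
  apply/eqP; rewrite -[_ == _]negbK -has_filter; apply/hasPn => u.
  by rewrite mem_filter => /andP[/andP[_ /gt_eqF yu] _]; rewrite /= yu.
have fNT : [seq u <- NT | zero u] = [::].
  apply/eqP; rewrite -[_ == _]negbK -has_filter; apply/hasPn => u.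
  by rewrite mem_filter => /andP[/andP[_ /lt_eqF yu] _]; rewrite /= yu.
have ft : [seq u <- t | zero u] = kap.
  by rewrite /t !filter_cat fPT fNT fM (all_filterP zk1) /= zkj ek /= -catA.
have mt : monotone y r false t.
  have [|mP cP] := @monotone_level _ _ y r false PT.
    by apply: sub_all (filter_all _ _) => u /andP[-> /ltW].
  have [|mk ck] := @monotone_level _ _ y r false k1.
    by apply/allP => u uk; rewrite (allP k1r _ uk) (eqP (allP zk1 _ uk)) lexx.
  have [|mN cN] := @monotone_level _ _ y r true NT.
    by apply: sub_all (filter_all _ _) => u /andP[-> /ltW].
  rewrite /t !monotone_cat !count_cat cP ck cN /= kjr /= mP mk mN mM.
  by rewrite (eqP zkj) lexx.
have pt : perm_eq t S.
  apply/seq.permP => q; rewrite /t !count_cat (seq.permP pM).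
  rewrite !count_cat !count_filter.
  have := seq.permP pk q; rewrite ek count_cat /= count_filter => kq.
  rewrite (count_by_sign y r q S) -kq; move: (count _ S) (count _ S).
  move: (count _ S) (count _ S) (count q k1) (nat_of_bool (q kj)) (count q k2).
  by clear; lia.
exists t => // a b c et b0 [hb wb].
have zb : all zero b.
  by apply: (@monotone_block_eq0 _ _ y r false a b c) wb; rewrite -et.
have ekap : kap = filter zero a ++ b ++ filter zero c.
  by rewrite -ft et !filter_cat (all_filterP zb).
have [a0 c0] := kapP _ _ _ ekap b0 hb.
have ha0 : ~~ has zero a by rewrite has_filter a0.
have hc0 : ~~ has zero c by rewrite has_filter c0.
have eb : b = kap by rewrite ekap a0 c0 cats0.
have k2r : has r k2.
  by have := hr b hb; rewrite eb rk2 /= negbK has_count; case: count.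
have k2M : has zero M by rewrite has_filter fM; case: (k2) k2r.
have kjz : has zero (PT ++ k1 ++ [:: kj]) by rewrite !has_cat /= zkj !orbT.
have sep t1 v t2 : t = t1 ++ v :: t2 -> ~~ zero v -> has zero t1 ->
    has zero t2 -> False.
  move=> et' zv h1 h2; have := separated_not_contiguous _ b0 zb zv h1 h2.
  by move=> /(_ a c); rewrite -et' -et (negPf ha0) (negPf hc0) => /(_ erefl).
have [/hasP[w wS wn]|hasN0] := boolP (has (fun u => y u < 0) S); last first.
  have npos : all (fun u => y u <= 0) S by move: hasN; rewrite (negPf hasN0).
  have zS : all zero S.
    apply/allP => u uS'; have := allP npos _ uS'; rewrite le_eqVlt.
    by case/orP => // un; case/hasP: hasN0; exists u.
  have zt : all zero t by rewrite (perm_all _ pt).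
  have := zt; rewrite et !all_cat => /and3P[za _ zc].
  have nil s : all zero s -> ~~ has zero s -> s = [::].
    by case: s => //= u s /andP[->].
  by split; apply: nil.
exfalso; case eN: NT => [|v NT'].
  case: headM => [N0|[v [M' [eM yv]]]].
    have : w \in NT ++ N.
      by rewrite mem_cat !mem_filter wS wn; case: (r w).
    by rewrite eN N0.
  apply: (sep (PT ++ k1 ++ [:: kj]) v M') => //.
    by rewrite /t eN eM.
  by move: k2M; rewrite eM /= (negPf yv).
have yv : ~~ zero v.
  have : v \in NT by rewrite eN inE eqxx.
  by rewrite mem_filter => /andP[/andP[_ yv] _]; rewrite /= ltr0_neq0.
apply: (sep (PT ++ k1 ++ [:: kj]) v (NT' ++ M)) => //; first by rewrite /t eN.
by rewrite has_cat k2M orbT.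
Qed.

(** The middle entry of the sorted list; strictness on one side settles the case
    of even length. *)
Lemma exists_median (R : realDomainType) (L : seq R) : L != [::] ->
  exists c, [/\ c \in L,
    (count (fun x => (c < x)%R) L <
       count (fun x => (x < c)%R) L + count (pred1 c) L)%N &
    (count (fun x => (x < c)%R) L <=
       count (fun x => (c < x)%R) L + count (pred1 c) L)%N].
Proof.
move=> L0; pose s := sort <=%O L; pose i := (size s)./2.
have pLs : perm_eq L s by rewrite perm_sym perm_sort.
have is_ : (i < size s)%N.
  have : (0 < size s)%N by rewrite size_sort lt0n size_eq0.
  by rewrite /i; move: (size s) => n; clear; lia.
pose c := nth 0 s i; exists c.
have es : s = take i s ++ c :: drop i.+1 s by rewrite -drop_nth ?cat_take_drop.
have : pairwise <=%O s.
  by rewrite -sorted_pairwise ?sort_le_sorted //; apply: le_trans.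
rewrite {1}es pairwise_cat /= allrel_consr => /and4P[/andP[lo _] _ hi _].
have n1 : count (fun x => c < x) s = count (fun x => c < x) (drop i.+1 s).
  rewrite {1}es count_cat /= ltxx add0n.
  rewrite [X in (X + _)%N](_ : _ = 0%N) ?add0n //; apply/eqP.
  rewrite -leqn0 leqNgt -has_count; apply/hasPn => x xs.
  by rewrite -leNgt; apply: (allP lo).
have n2 : count (fun x => x < c) s = count (fun x => x < c) (take i s).
  rewrite {1}es count_cat /= ltxx add0n.
  rewrite [X in (_ + X)%N](_ : _ = 0%N) ?addn0 //; apply/eqP.
  rewrite -leqn0 leqNgt -has_count; apply/hasPn => x xs.
  by rewrite -leNgt; apply: (allP hi).
have n3 : (count (fun x => x < c)%R s + count (fun x => c < x)%R s +
    count (pred1 c) s = size s)%N.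
  elim: (s) => //= x s' IH; rewrite -IH.
  move: (count _ s') (count _ s') (count _ s').
  by case: ltgtP; clear; lia.
have b1 := count_size (fun x => c < x) (drop i.+1 s).
have b2 := count_size (fun x => x < c) (take i s).
move: b1 b2; rewrite -n1 -n2 size_drop size_take_min => b1 b2.
rewrite (perm_mem pLs) mem_nth // !(seq.permP pLs).
have ei : i = (size s)./2 by [].
move: n3 b1 b2 ei is_; move: (count _ s) (count _ s) (count _ s) (i) (size s).
by clear; split=> //; lia.
Qed.

Lemma odd_count_char (T : Type) (H : finGroupType) (h : T -> H)
    (rho : H -> bool) s :
  {morph rho : x z / (x * z)%g >-> x (+) z} ->
  odd (count (rho \o h) s) = rho (\prod_(u <- s) h u)%g.
Proof.
move=> rhoM; elim: s => [|u s IH].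
  by rewrite big_nil; have := rhoM 1%g 1%g; rewrite mulg1; case: (rho _).
by rewrite big_cons /= oddD oddb IH rhoM.
Qed.

(** After recentering at a median of the reflections, the only obstacle to
    [balanced_reflections_sequence] is that positive terms may occur without
    negative ones.  Changing all signs removes it: the size conditions survive,
    since there are then fewer positive than zero reflections. *)
Lemma reflections_sequence (T : eqType) (R : realDomainType)
    (H : finGroupType) (h : T -> H) (rho : H -> bool) (y : T -> R)
    (S : seq T) :
  strongly_sequenceable H -> {morph rho : x z / (x * z)%g >-> x (+) z} ->
  uniq S -> {in S &, forall u v, y u = y v -> h u = h v -> u = v} ->
  {in S, forall u, y u = 0 -> h u != 1%g} -> has (rho \o h) S ->
  exists2 t, perm_eq t S & no_proper_block (zero_block h y (rho \o h)) t.
Proof.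
move=> sH rhoM uS injS S1 rS; set r : pred T := rho \o h.
have rho1 : rho 1%g = false.
  by have := odd_count_char h [::] rhoM; rewrite big_nil.
have hr s : (\prod_(u <- s) h u = 1)%g -> ~~ odd (count r s).
  by rewrite /r odd_count_char // => ->; rewrite rho1.
have [|c [cL cgt clt]] := @exists_median _ [seq y u | u <- S & r u].
  by rewrite -size_eq0 size_map size_filter -lt0n -has_count.
pose z := recenter r y c.
have zinj : {in S &, forall u v, z u = z v -> h u = h v -> u = v}.
  move=> u v uS' vS zz hh; apply: injS => //; move: zz.
  by rewrite /z /recenter /r /= hh; case: ifP => // _ /addIr.
have z1 : {in S, forall u, z u = 0 -> h u != 1%g}.
  move=> u uS' zu; apply/eqP => hu; have := S1 _ uS'.
  by move: zu; rewrite /z /recenter /r /= hu rho1 => -> /(_ erefl)/eqP.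
have zZ b : zero_block h y r b -> zero_block h z r b.
  case=> hb wb; split=> //.
  by rewrite walk_recenter wb (negPf (hr _ hb)) subrr.
have cnt (p : pred R) : count p [seq y u | u <- S & r u] =
    size [seq u <- S | r u & p (y u)].
  rewrite count_map count_filter size_filter; apply: eq_count => u /=.
  by rewrite andbC.
rewrite !cnt in cgt clt.
have ez (p q : pred R) : (forall x, p (x - c) = q x) ->
    [seq u <- S | r u & p (z u)] = [seq u <- S | r u & q (y u)].
  move=> pq; apply: eq_filter => u /=; rewrite /z /recenter.
  by case: (r u) => //=; rewrite pq.
have eP := ez (fun x => 0 < x) (fun x => c < x) (fun x => subr_gt0 c x).
have eN := ez (fun x => x < 0) (fun x => x < c) (fun x => subr_lt0 c x).
have eC := ez (fun x => x == 0) (pred1 c) (fun x => subr_eq0 x c).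
rewrite -eP -eN -eC in cgt clt.
have C0 : [seq u <- S | r u & z u == 0] != [::].
  rewrite eC -has_filter; case/mapP: cL => u.
  rewrite mem_filter => /andP[ru uS'].
  by move=> ec; apply/hasP; exists u => //; rewrite /= ru ec eqxx.
case: (boolP (has (fun u => z u < 0) S || all (fun u => z u <= 0) S)) => hz.
  have [t pt tP] :=
    balanced_reflections_sequence sH hr uS zinj z1 C0 cgt clt hz.
  by exists t => //; apply: sub_no_proper_block tP.
move: hz; rewrite negb_or => /andP[hN hP].
pose z' u := - z u.
have eP' : [seq u <- S | r u & 0 < z' u] = [seq u <- S | r u & z u < 0].
  by apply: eq_filter => u; rewrite oppr_gt0.
have eN' : [seq u <- S | r u & z' u < 0] = [seq u <- S | r u & 0 < z u].
  by apply: eq_filter => u; rewrite oppr_lt0.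
have eC' : [seq u <- S | r u & z' u == 0] = [seq u <- S | r u & z u == 0].
  by apply: eq_filter => u; rewrite oppr_eq0.
have N0 : [seq u <- S | r u & z u < 0] = [::].
  apply/eqP; rewrite -[_ == _]negbK -has_filter; apply: contra hN.
  by apply: sub_has => u /andP[].
have [||||||t pt tP] :=
    @balanced_reflections_sequence _ _ _ h z' r S sH hr uS.
- by move=> u v uS' vS /oppr_inj; apply: zinj.
- by move=> u uS' /eqP; rewrite oppr_eq0 => /eqP; apply: z1.
- by rewrite eC'.
- by rewrite eP' eN' eC' N0 addn_gt0 orbC lt0n size_eq0 C0.
- by rewrite eP' eN' eC' N0; move: cgt; rewrite N0 => /ltnW.
- case/allPn: hP => u uS'; rewrite -ltNge => zu.
  by apply/orP; left; apply/hasP; exists u => //; rewrite oppr_lt0.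
exists t => //; apply: sub_no_proper_block tP => b /zZ[hb wb]; split=> //.
by rewrite walk_opp wb oppr0.
Qed.

(** * Sequencing sets of translations *)

Lemma perm_prodg (T : eqType) (H : finGroupType) (h : T -> H) s1 s2 :
  abelian [set: H] -> perm_eq s1 s2 ->
  (\prod_(u <- s1) h u = \prod_(u <- s2) h u)%g.
Proof.
move=> /centsP cH; move: s1 s2; apply: catCA_perm_subst => a b c.
rewrite !big_cat /= !mulgA; congr (_ * _)%g.
by apply: cH; rewrite inE.
Qed.

Section Translations.
Variables (T : eqType) (R : realDomainType) (H : finGroupType) (h : T -> H).
Hypothesis cH : abelian [set: H].
Implicit Types (y : T -> R) (s : seq T).

Definition sum_zero y s :=
  ((\prod_(u <- s) h u)%g == 1%g) && (\sum_(u <- s) y u == 0).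

Lemma perm_sum_zero y s1 s2 :
  perm_eq s1 s2 -> sum_zero y s1 = sum_zero y s2.
Proof.
by move=> p12; rewrite /sum_zero (perm_prodg h cH p12) (perm_big _ p12).
Qed.

Lemma sum_zero_opp y s : sum_zero (fun u => - y u) s = sum_zero y s.
Proof. by rewrite /sum_zero sumrN oppr_eq0. Qed.

Lemma sum_zero_cons_inj y p1 p2 s1 s2 : perm_eq (p1 :: s1) (p2 :: s2) ->
  sum_zero y s1 -> sum_zero y s2 -> h p1 = h p2 /\ y p1 = y p2.
Proof.
move=> p12 /andP[/eqP h1 /eqP y1] /andP[/eqP h2 /eqP y2].
have := perm_prodg h cH p12.
have : \sum_(u <- p1 :: s1) y u = \sum_(u <- p2 :: s2) y u by apply: perm_big.
by rewrite !big_cons h1 h2 y1 y2 !addr0 !mulg1.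
Qed.

Lemma sum_zeros y s : all (fun u => y u == 0) s -> \sum_(u <- s) y u = 0.
Proof. by move/allP=> s0; rewrite big_seq big1 // => u /s0/eqP. Qed.

Lemma sum_pos_ge0 y s : all (fun u => 0 < y u) s -> 0 <= \sum_(u <- s) y u.
Proof. by move/allP=> sp; rewrite big_seq sumr_ge0 // => u /sp/ltW. Qed.

Lemma sum_pos y s :
  all (fun u => 0 < y u) s -> s <> [::] -> 0 < \sum_(u <- s) y u.
Proof.
case: s => //= u s /andP[yu sp] _; rewrite big_cons.
by apply: ltr_wpDr yu; apply: sum_pos_ge0.
Qed.

Lemma sum_neg y s :
  all (fun u => y u < 0) s -> s <> [::] -> \sum_(u <- s) y u < 0.
Proof.
move=> sn s0; rewrite -oppr_gt0 -sumrN; apply: sum_pos => //.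
by apply: sub_all sn => u; rewrite oppr_gt0.
Qed.

(** Two distinct terms cannot both leave a remainder with sum zero, for then
    they would be equal. *)
Lemma removable y (P s : seq T) : uniq P -> P <> [::] ->
  {in P &, forall u v, y u = y v -> h u = h v -> u = v} ->
  exists2 p, p \in P & rem p P <> [::] -> ~~ sum_zero y (rem p P ++ s).
Proof.
case: P => // p1 [|p2 P] uP _ injP.
  by exists p1; rewrite ?inE ?eqxx //= eqxx.
have p12 : p1 != p2 by move: uP => /= /andP[]; rewrite inE negb_or => /andP[].
set P' := [:: p1, p2 & P] in uP injP *.
have i1 : p1 \in P' by rewrite inE eqxx.
have i2 : p2 \in P' by rewrite !inE eqxx orbT.
case: (boolP (sum_zero y (rem p1 P' ++ s))) => z1; last by exists p1.
exists p2 => // _; apply: contra p12 => z2.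
have [|e1 e2] := @sum_zero_cons_inj y p1 p2 _ _ _ z1 z2; last first.
  by apply/eqP; apply: injP.
rewrite -!cat_cons perm_cat2r.
apply: perm_trans (perm_to_rem i2); rewrite perm_sym.
exact: perm_to_rem.
Qed.

(** Both lists are read from the inside out: their heads are the terms next to
    the block w that lies between them. *)
Definition uncrossed y (w P N : seq T) := forall i j,
  (0 < i <= size P)%N -> (0 < j <= size N)%N ->
  ~~ sum_zero y (take i P ++ take j N ++ w).

(** The inductive step for a nonnegative total; the case of a negative total is
    obtained from it by symmetry, so the induction hypothesis is an explicit
    premise.  The term p chosen by [removable] becomes the outermost positive
    one.  The new blocks contain all of P: with all of N they are nonzero by
    hypothesis, and with less of N their coordinate exceeds the nonnegative
    total. *)
Lemma uncrossed_orders_step y w P N n :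
  (forall P1 N1, (size P1 + size N1 <= n)%N -> uniq P1 -> uniq N1 ->
    all (fun u => 0 < y u) P1 -> all (fun u => y u < 0) N1 ->
    {in P1 &, forall u v, y u = y v -> h u = h v -> u = v} ->
    {in N1 &, forall u v, y u = y v -> h u = h v -> u = v} ->
    (P1 <> [::] -> N1 <> [::] -> ~~ sum_zero y (P1 ++ N1 ++ w)) ->
    exists P' N', [/\ perm_eq P' P1, perm_eq N' N1 & uncrossed y w P' N']) ->
  (size P + size N <= n.+1)%N -> uniq P -> uniq N ->
  all (fun u => 0 < y u) P -> all (fun u => y u < 0) N ->
  {in P &, forall u v, y u = y v -> h u = h v -> u = v} ->
  {in N &, forall u v, y u = y v -> h u = h v -> u = v} ->
  all (fun u => y u == 0) w ->
  P <> [::] -> ~~ sum_zero y (P ++ N ++ w) ->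
  0 <= \sum_(u <- P) y u + \sum_(u <- N) y u ->
  exists P' N', [/\ perm_eq P' P, perm_eq N' N & uncrossed y w P' N'].
Proof.
move=> IH szn uP uN yP yN injP injN yw P0 nz tot.
have [p pP prem] := removable (N ++ w) uP P0 injP.
have pR := perm_to_rem pP.
have [||||||||P1 [N1 [pP1 pN1 unc]]] := IH (rem p P) N.
- by move: szn; rewrite (perm_size pR) /= addSn ltnS.
- exact: rem_uniq.
- by [].
- by apply/allP => u /mem_rem; apply: (allP yP).
- by [].
- by move=> u v /mem_rem uP' /mem_rem; apply: injP.
- by [].
- by move=> r0 _; apply: prem.
exists (rcons P1 p), N1; split=> //.
  rewrite perm_rcons perm_sym; apply: perm_trans pR _.
  by rewrite perm_cons perm_sym.
move=> i j; rewrite size_rcons => /andP[i0]; rewrite leq_eqVlt => /orP[/eqP->|];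
    last first.
  rewrite ltnS => iP jN; rewrite -cats1 takel_cat //.
  by apply: unc => //; rewrite i0.
have pP' : perm_eq (rcons P1 p) P.
  rewrite perm_rcons perm_sym; apply: perm_trans pR _.
  by rewrite perm_cons perm_sym.
rewrite take_oversize ?size_rcons // => /andP[j0].
rewrite leq_eqVlt => /orP[/eqP->|jN].
  rewrite take_size; apply: contra nz.
  rewrite (perm_sum_zero y (s2 := P ++ N ++ w)) //.
  by rewrite perm_cat // perm_cat2r.
apply/negP => /andP[_ /eqP]; rewrite !big_cat /= (sum_zeros yw) addr0.
rewrite (perm_big _ pP') /=.
apply/eqP; apply: lt0r_neq0; apply: le_lt_trans tot _.
rewrite -(perm_big _ pN1) -{1}(cat_take_drop j N1) big_cat /= addrA.
rewrite -[X in _ < X]addr0 ltrD2l; apply: sum_neg.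
  apply/allP => u /mem_drop; rewrite (perm_mem pN1); exact: (allP yN).
by move=> /(congr1 size)/eqP; rewrite size_drop subn_eq0 leqNgt jN.
Qed.

(** If the total is negative, changing all signs exchanges P and N. *)
Lemma uncrossed_orders y w P N : uniq P -> uniq N ->
  all (fun u => 0 < y u) P -> all (fun u => y u < 0) N ->
  {in P &, forall u v, y u = y v -> h u = h v -> u = v} ->
  {in N &, forall u v, y u = y v -> h u = h v -> u = v} ->
  all (fun u => y u == 0) w ->
  (P <> [::] -> N <> [::] -> ~~ sum_zero y (P ++ N ++ w)) ->
  exists P' N', [/\ perm_eq P' P, perm_eq N' N & uncrossed y w P' N'].
Proof.
have [n] := ubnPleq (size P + size N)%N.
elim: n y P N => [|n IH] y P N szn uP uN yP yN injP injN yw nz.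
  exists P, N; split=> // i j /andP[i0 iP]; move: szn; rewrite leqn0 addn_eq0.
  by case/andP => /eqP P0; move: iP; rewrite P0 leqn0 -[i == _]negbK -lt0n i0.
case: (altP (P =P [::])) => [P0|/eqP P0].
  by exists P, N; split=> // i j; rewrite P0 /= => /andP[]; case: i.
case: (altP (N =P [::])) => [N0|/eqP N0].
  by exists P, N; split=> // i j _; rewrite N0 /= => /andP[]; case: j.
have nz' := nz P0 N0.
case: (lerP 0 (\sum_(u <- P) y u + \sum_(u <- N) y u)) => tot.
  apply: (uncrossed_orders_step (n := n)) => // P1 N1 *; exact: IH.
pose z u := - y u.
have flip s : all (fun u => z u == 0) s = all (fun u => y u == 0) s.
  by apply: eq_all => u; rewrite oppr_eq0.
have inj' s : {in s &, forall u v, y u = y v -> h u = h v -> u = v} ->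
    {in s &, forall u v, z u = z v -> h u = h v -> u = v}.
  by move=> si u v us vs /oppr_inj; apply: si.
have [||||||||||||N' [P' [pN pP unc]]] := @uncrossed_orders_step z w N P n.
- by move=> P1 N1 *; apply: IH => //; rewrite flip.
- by rewrite addnC.
- by [].
- by [].
- by apply: sub_all yN => u; rewrite oppr_gt0.
- by apply: sub_all yP => u; rewrite oppr_lt0.
- exact: inj'.
- exact: inj'.
- by rewrite flip.
- by [].
- rewrite sum_zero_opp; apply: contra nz'.
  by rewrite (perm_sum_zero y (s2 := P ++ N ++ w)) // perm_catCA.
- by rewrite !sumrN -opprD oppr_ge0 addrC ltW.
exists P', N'; split=> // i j iP jN; have := unc j i jN iP.
rewrite sum_zero_opp; apply: contra.
by rewrite (perm_sum_zero y (s2 := take j N' ++ take i P' ++ w)) // perm_catCA.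
Qed.

Lemma valley_no_block y (P kap N : seq T) :
  all (fun u => 0 < y u) P -> all (fun u => y u < 0) N ->
  all (fun u => y u == 0) kap ->
  no_block (fun b => \prod_(u <- b) h u = 1)%g kap ->
  (forall a p q c, P = a ++ p -> N = q ++ c -> p <> [::] -> q <> [::] ->
     ~~ sum_zero y (p ++ kap ++ q)) ->
  no_block (sum_zero y) (P ++ kap ++ N).
Proof.
move=> yP yN yk kapP cross.
have pos s : 0 < \sum_(u <- s) y u -> ~ sum_zero y s.
  by move=> sp /andP[_ /eqP s0]; rewrite s0 ltxx in sp.
have neg s : \sum_(u <- s) y u < 0 -> ~ sum_zero y s.
  by move=> sp /andP[_ /eqP s0]; rewrite s0 ltxx in sp.
apply: no_block_cat; [|apply: no_block_cat|].
- move=> a b c eP b0; apply: pos; apply: sum_pos => //.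
  by move: yP; rewrite eP !all_cat => /and3P[].
- by move=> a b c ek b0 /andP[/eqP hb _]; apply: (kapP a b c).
- move=> a b c eN b0; apply: neg; apply: sum_neg => //.
  by move: yN; rewrite eN !all_cat => /and3P[].
- move=> a p q c ek eN p0 q0; apply: neg; rewrite big_cat /= sum_zeros ?add0r.
    by apply: sum_neg => //; move: yN; rewrite eN all_cat => /andP[].
  by move: yk; rewrite ek all_cat => /andP[].
- move=> a p q c eP ekN p0 q0.
  have yp : 0 < \sum_(u <- p) y u.
    by apply: sum_pos => //; move: yP; rewrite eP all_cat => /andP[].
  case: (cat_overlap ekN) => e [[eq eN]|[ek _]]; last first.
    apply: pos; rewrite big_cat /= (sum_zeros (s := q)) ?addr0 //.
    by move: yk; rewrite ek all_cat => /andP[].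
  case: e eq eN => [|x e] eq eN; rewrite eq.
    by apply: pos; rewrite cats0 big_cat /= (sum_zeros yk) addr0.
  by apply/negP; apply: (cross a p (x :: e) c).
Qed.

Lemma prepend_no_proper_block y x (P kap N : seq T) :
  all (fun u => 0 < y u) P -> all (fun u => y u < 0) N ->
  all (fun u => y u == 0) kap ->
  no_block (sum_zero y) (P ++ kap ++ N) ->
  0 <= y x -> ~~ sum_zero y [:: x] -> 0 < y x + \sum_(u <- P) y u ->
  0 <= y x + \sum_(u <- P) y u + \sum_(u <- N) y u ->
  no_proper_block (sum_zero y) (x :: P ++ kap ++ N).
Proof.
move=> yP yN yk rest yx x1 xP tot; apply: no_proper_block_cons => // q c es c0.
case: q es => [|v q] es; first exact/negP.
suff : 0 < y x + \sum_(u <- v :: q) y u.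
  by move=> sp /andP[_ /eqP]; rewrite big_cons => s0; rewrite s0 ltxx in sp.
case: (cat_overlap es) => e [[-> ekN]|[eP _]]; last first.
  apply: ltr_wpDl => //; apply: sum_pos => //.
  by move: yP; rewrite eP all_cat => /andP[].
rewrite big_cat /= addrA.
case: (cat_overlap ekN) => f [[-> eN]|[ek _]]; last first.
  rewrite (sum_zeros (s := e)) ?addr0 //.
  by move: yk; rewrite ek all_cat => /andP[].
rewrite big_cat /= (sum_zeros yk) add0r; apply: le_lt_trans tot _.
rewrite eN big_cat /= addrA -[X in _ < X]addr0 ltrD2l; apply: sum_neg => //.
by move: yN; rewrite eN all_cat => /andP[].
Qed.

Lemma perm_by_sign y s :
  perm_eq ([seq u <- s | 0 < y u] ++ [seq u <- s | y u < 0] ++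
           [seq u <- s | y u == 0]) s.
Proof.
apply/seq.permP => q; rewrite !count_cat !count_filter.
elim: s => //= u s <-; move: (count _ s) (count _ s) (count _ s).
by case: (ltgtP (y u)) (q u) => _ [] /=; clear; lia.
Qed.

Lemma valley_sequence y (P kap N : seq T) : uniq P -> uniq N ->
  all (fun u => 0 < y u) P -> all (fun u => y u < 0) N ->
  {in P &, forall u v, y u = y v -> h u = h v -> u = v} ->
  {in N &, forall u v, y u = y v -> h u = h v -> u = v} ->
  all (fun u => y u == 0) kap ->
  no_block (fun b => \prod_(u <- b) h u = 1)%g kap ->
  ~~ sum_zero y (P ++ N ++ kap) ->
  exists P' N', [/\ perm_eq P' P, perm_eq N' N &
    no_block (sum_zero y) (P' ++ kap ++ N')].
Proof.
move=> uP uN yP yN injP injN yk kapP nz.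
have [P' [N' [pP pN unc]]] :=
  uncrossed_orders uP uN yP yN injP injN yk (fun _ _ => nz).
exists (rev P'), N'; rewrite (permPl (permEl (perm_rev _))); split=> //.
apply: valley_no_block => //.
- by rewrite all_rev (perm_all _ pP).
- by rewrite (perm_all _ pN).
move=> a p q c /(congr1 rev); rewrite revK rev_cat => eP eN p0 q0.
have := unc (size p) (size q).
rewrite eP {1}eN !size_cat size_rev !leq_addr !andbT.
rewrite -(size_rev p) take_size_cat // eN take_size_cat // size_rev.
have p1 : (0 < size p)%N by case: (p) p0.
have q1 : (0 < size q)%N by case: (q) q0.
move=> /(_ p1 q1); apply: contra.
rewrite (perm_sum_zero y (s2 := rev p ++ q ++ kap)) //.
by apply: perm_cat; [rewrite perm_sym perm_rev | rewrite perm_catC].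
Qed.

(** The middle block must have no trivial sub-block, itself included.  If the
    terms of coordinate 0 sum to zero, one of them, z, is moved to the front:
    the others then have nontrivial sum, and z is chosen such that all terms but
    z do not sum to zero.  If instead all of S sums to zero, a positive term p
    plays the part of z. *)
Lemma translations_sequence_ge0 y (S : seq T) :
  strongly_sequenceable H -> uniq S ->
  {in S &, forall u v, y u = y v -> h u = h v -> u = v} ->
  {in S, forall u, y u = 0 -> h u != 1%g} ->
  0 <= \sum_(u <- S) y u ->
  exists2 t, perm_eq t S & no_proper_block (sum_zero y) t.
Proof.
move=> sH uS injS S1 totS.
pose P := [seq u <- S | 0 < y u]; pose N := [seq u <- S | y u < 0].
pose K := [seq u <- S | y u == 0]; have pS := perm_by_sign y S.
rewrite -/P -/N -/K in pS.
have kapE (K' : seq T) : uniq K' -> {subset K' <= K} -> exists2 kap,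
    perm_eq kap K' & no_proper_block (fun b => \prod_(u <- b) h u = 1)%g kap.
  move=> uK sK; apply: strongly_sequenceable_seq => //.
    move=> u v /sK; rewrite mem_filter => /andP[/eqP yu uS'].
    move=> /sK; rewrite mem_filter => /andP[/eqP yv vS].
    by apply: injS => //; rewrite yu yv.
  by move=> u /sK; rewrite mem_filter => /andP[/eqP yu uS']; apply: S1.
have injF (p : pred T) : {in [seq u <- S | p u] &,
    forall u v, y u = y v -> h u = h v -> u = v}.
  by move=> u v; rewrite !mem_filter => /andP[_ us] /andP[_ vs]; apply: injS.
have uP : uniq P by exact: filter_uniq.
have uN : uniq N by exact: filter_uniq.
have uK : uniq K by exact: filter_uniq.
have yP : all (fun u => 0 < y u) P by exact: filter_all.
have yN : all (fun u => y u < 0) N by exact: filter_all.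
have yK : all (fun u => y u == 0) K by exact: filter_all.
have totPN : 0 <= \sum_(u <- P) y u + \sum_(u <- N) y u.
  move: totS; rewrite -(perm_big _ pS) /= !big_cat /=.
  by rewrite (sum_zeros yK) addr0.
have [kap pk kapP] := kapE K uK (fun _ => id).
have yk : all (fun u => y u == 0) kap by rewrite (perm_all _ pk).
case: (altP (P =P [::])) => [P0|/eqP P0].
  have N0 : N = [::].
    case: (altP (N =P [::])) => // /eqP /(sum_neg yN).
    by move: totPN; rewrite P0 big_nil add0r leNgt => /negPf->.
  exists kap; first by move: pS; rewrite P0 N0; apply: perm_trans.
  by apply: sub_no_proper_block kapP => b /andP[/eqP].
case: (boolP ((K != [::]) && (\prod_(u <- K) h u == 1)%g)) => [|nK].
  move=> /andP[/eqP K0 /eqP hK].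
  have [z zK nz] := removable (P ++ N) uK K0 (injF _).
  have pz := perm_to_rem zK.
  have := zK; rewrite mem_filter => /andP[/eqP yz zS].
  have hz := S1 z zS yz.
  have remK : (\prod_(u <- rem z K) h u != 1)%g.
    apply: contra hz => /eqP hr; move: hK.
    by rewrite (perm_prodg h cH pz) big_cons hr mulg1 => ->.
  have rem0 : rem z K <> [::] by move=> r0; rewrite r0 big_nil eqxx in remK.
  have [||k' pk' k'P] := kapE (rem z K); first exact: rem_uniq.
    by move=> u /mem_rem.
  have yk' : all (fun u => y u == 0) k'.
    by rewrite (perm_all _ pk'); apply/allP => u /mem_rem; apply: (allP yK).
  have sk' : no_block (fun b => \prod_(u <- b) h u = 1)%g k'.
    apply: no_proper_block_nonzero k'P _.
    by rewrite (perm_prodg h cH pk'); apply/eqP.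
  have [|P' [N' [pP pN nb]]] :=
      valley_sequence uP uN yP yN (injF _) (injF _) yk' sk'.
    apply: contra (nz rem0).
    rewrite (perm_sum_zero y (s2 := rem z K ++ P ++ N)) //.
    by rewrite catA perm_catC perm_cat.
  exists (z :: P' ++ k' ++ N').
    apply: perm_trans pS; apply/seq.permP => q; rewrite /= !count_cat.
    rewrite (seq.permP pP) (seq.permP pN) (seq.permP pk') (seq.permP pz) /=.
    rewrite addnCA; congr addn.
    by rewrite [RHS]addnCA [in RHS](addnC (count q N)).
  have sP : \sum_(u <- P') y u = \sum_(u <- P) y u by apply: perm_big.
  have sN : \sum_(u <- N') y u = \sum_(u <- N) y u by apply: perm_big.
  apply: prepend_no_proper_block => //.
  - by rewrite (perm_all _ pP).
  - by rewrite (perm_all _ pN).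
  - by rewrite yz.
  - by rewrite /sum_zero big_seq1 (negPf hz).
  - by rewrite yz add0r sP; apply: sum_pos.
  - by rewrite yz add0r sP sN.
have sk : no_block (fun b => \prod_(u <- b) h u = 1)%g kap.
  case: (altP (K =P [::])) nK => [K0 _|_ /= nK].
    have -> : kap = [::] by apply/nilP; rewrite /nilp (perm_size pk) K0.
    by move=> [|//] [|//].
  apply: no_proper_block_nonzero kapP _.
  by rewrite (perm_prodg h cH pk); apply/eqP.
have pSk : perm_eq (P ++ N ++ kap) S.
  by apply: perm_trans pS; rewrite !perm_cat2l.
case: (boolP (sum_zero y (P ++ N ++ kap))) => [z0|nz]; last first.
  have [P' [N' [pP pN nb]]] :=
    valley_sequence uP uN yP yN (injF _) (injF _) yk sk nz.
  exists (P' ++ kap ++ N'); last exact: no_block_proper.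
  by apply: perm_trans pSk; apply: perm_cat; rewrite // perm_catC perm_cat.
case eP : P P0 => [//|p P1] _.
have := yP; rewrite eP /= => /andP[yp yP1].
have := uP; rewrite eP /= => /andP[_ uP1].
have injP1 : {in P1 &, forall u v, y u = y v -> h u = h v -> u = v}.
  move=> u v uP' vP'; apply: (injF (fun u => 0 < y u)); rewrite -/P eP inE.
    by rewrite uP' orbT.
  by rewrite vP' orbT.
have [|P' [N' [pP pN nb]]] :=
    valley_sequence uP1 uN yP1 yN injP1 (injF _) yk sk.
  apply/negP => /andP[_ /eqP z1]; move: z0 => /andP[_ /eqP].
  by rewrite eP /= big_cons z1 addr0 => yp0; rewrite yp0 ltxx in yp.
have sP : \sum_(u <- P') y u = \sum_(u <- P1) y u by apply: perm_big.
have sN : \sum_(u <- N') y u = \sum_(u <- N) y u by apply: perm_big.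
exists (p :: P' ++ kap ++ N').
  apply: perm_trans pSk; rewrite eP /= perm_cons.
  by apply: perm_cat; rewrite // perm_catC perm_cat.
apply: prepend_no_proper_block => //.
- by rewrite (perm_all _ pP).
- by rewrite (perm_all _ pN).
- exact: ltW.
- by rewrite /sum_zero !big_seq1 (gt_eqF yp) andbF.
- by apply: ltr_wpDr => //; rewrite sP; apply: sum_pos_ge0.
- by rewrite sP sN; move: totPN; rewrite eP big_cons.
Qed.

End Translations.

Lemma translations_sequence (T : eqType) (R : realDomainType)
    (H : finGroupType) (h : T -> H) (r : pred T) (y : T -> R) (S : seq T) :
  abelian [set: H] -> strongly_sequenceable H -> uniq S ->
  {in S &, forall u v, y u = y v -> h u = h v -> u = v} ->
  {in S, forall u, y u = 0 -> h u != 1%g} -> ~~ has r S ->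
  exists2 t, perm_eq t S & no_proper_block (zero_block h y r) t.
Proof.
move=> cH sH uS injS S1 rS.
have walkE s : {subset s <= S} -> walk y r false s = \sum_(u <- s) y u.
  elim: s => [|u s IH] sS; first by rewrite big_nil.
  have ru : r u = false.
    by apply: negbTE; apply: (hasPn rS); apply: sS; rewrite inE eqxx.
  by rewrite /= ru big_cons IH // => v vs; apply: sS; rewrite inE vs orbT.
have [t pt tP] : exists2 t, perm_eq t S & no_proper_block (sum_zero h y) t.
  case: (lerP 0 (\sum_(u <- S) y u)) => tot.
    exact: translations_sequence_ge0.
  have [|||t pt tP] :=
      @translations_sequence_ge0 _ _ _ h cH (fun u => - y u) S sH uS.
  - by move=> u v us vs /oppr_inj; apply: injS.
  - by move=> u us /eqP; rewrite oppr_eq0 => /eqP; apply: S1.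
  - by rewrite sumrN oppr_ge0 ltW.
  by exists t => //; apply: sub_no_proper_block tP => b; rewrite sum_zero_opp.
exists t => // a b c et b0 [hb wb]; apply: (tP a b c et b0).
rewrite /sum_zero hb eqxx -walkE ?wb ?eqxx // => u ub.
by rewrite -(perm_mem pt) et !mem_cat ub orbT.
Qed.

(** * Semidirect products *)

Section WalkCoefficients.
Variables (T : finType) (r : pred T).

Definition walk_coef (b : bool) (s : seq T) (u : T) : int :=
  walk (fun v => (v == u)%:Z) r b s.

Lemma walk_coefE (V : zmodType) (y : T -> V) (S : {set T}) b s :
  {subset s <= S} -> walk y r b s = \sum_(u in S) y u *~ walk_coef b s u.
Proof.
elim: s b => [|v s IH] b sS /=; first by rewrite big1 // => u _; rewrite mulr0z.
rewrite IH; last by move=> u us; apply: sS; rewrite inE us orbT.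
under [in RHS]eq_bigr do rewrite /walk_coef /= mulrzDr.
rewrite big_split /=; congr (_ + _).
have vS : v \in S by apply: sS; rewrite inE eqxx.
rewrite (bigD1 v) //= eqxx big1 ?addr0 => [|u /andP[_ uv]].
  by case: b; rewrite ?mulrNz mulr1z.
by rewrite eq_sym (negPf uv) oppr0 if_same mulr0z.
Qed.

Lemma walk_coef_le1 b s u : uniq s -> `|walk_coef b s u| <= 1.
Proof.
have out b' s' : u \notin s' -> walk_coef b' s' u = 0.
  elim: s' b' => //= v s' IH b'; rewrite inE negb_or => /andP[uv us].
  rewrite /walk_coef /= -/(walk_coef _ _ _) IH //.
  by rewrite eq_sym (negPf uv) oppr0 if_same.
elim: s b => [|v s IH] b; first by rewrite /walk_coef /= normr0.
move=> /= /andP[vs us]; rewrite /walk_coef /= -/(walk_coef _ _ _).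
case: eqP => [vu|_]; last by rewrite oppr0 if_same add0r IH.
by rewrite out -?vu // addr0; case: (b).
Qed.

End WalkCoefficients.

Lemma rational_walk_model (T : finType) (S : {set T}) (m : nat) (x : T -> int) :
  (0 < m)%N -> (forall p : nat, prime p -> (p %| m)%N -> (#|S|`! < p)%N) ->
  exists y : T -> rat, forall (r : pred T) b s, uniq s -> {subset s <= S} ->
    (m %| walk x r b s)%Z = (walk y r b s == 0).
Proof.
move=> m0 mP; have [y yP] := rational_model x m0 mP.
exists y => r b s us sS; rewrite !(walk_coefE _ _ _ sS).
rewrite -[in RHS](eq_bigr _ (fun u _ => mulrzl (y u) (walk_coef r b s u))).
rewrite -yP => [|u]; last exact: walk_coef_le1.
by congr (_ %| _)%Z; apply: eq_bigr => u _; rewrite mulrzz mulrC.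
Qed.

(** Both sides are images of one integer under the additive map that sends z to z
    times 1; the argument is additive because 'I_n.+1 is not a ring when n = 0. *)
Lemma walk_Zp_eq0 (T : Type) (n : nat) (x : T -> 'I_n.+1) (r : pred T) b s :
  (walk x r b s == 0) = (n.+1 %| walk (fun u => (x u : nat)%:Z) r b s)%Z.
Proof.
have xE u : x u = Zp1 *~ (x u : nat)%:Z.
  apply: val_inj; rewrite -pmulrn Zp_mulrn /= modnMml mul1n modn_small //.
have -> : walk x r b s = Zp1 *~ walk (fun u => (x u : nat)%:Z) r b s.
  elim: s b => [|u s IH] b //=; rewrite IH mulrzDr; congr (_ + _).
  by case: b; rewrite ?mulrNz -xE.
have E (k : nat) : ((Zp1 : 'I_n.+1) *+ k == 0) = (n.+1 %| k)%N.
  by rewrite Zp_mulrn -val_eqE /= modnMml mul1n.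
case: (walk _ _ _ _) => k; rewrite /dvdz /=; first by rewrite -pmulrn E.
by rewrite NegzE mulrNz oppr_eq0 -pmulrn E.
Qed.

Section Semidirect.
Variables (m : nat) (H : finGroupType) (phi : aut_hom H (Zmod m)).
Hypothesis phiP : id_or_opp phi.

Definition residue (u : semidirect phi) : Zmod m := (sdval u).1.
Definition hpart (u : semidirect phi) : H := (sdval u).2.

Definition reflects (g : H) : bool := [exists x, phi g x != x].

Lemma reflectsE g x : phi g x = if reflects g then (- x)%R else x.
Proof.
rewrite /reflects; case: existsP => [[z zP]|nz].
  by case: (phiP g) => // gid; rewrite gid eqxx in zP.
by apply/eqP; apply: contraT => xP; case: nz; exists x.
Qed.

(** If negation is the identity of Z/m, nothing reflects and the claim is
    trivial; otherwise the two possible actions are distinct. *)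
Lemma reflectsM : {morph reflects : g f / (g * f)%g >-> g (+) f}.
Proof.
move=> g f; have gfE x : phi (g * f)%g x =
    if reflects g (+) reflects f then (- x)%R else x.
  rewrite aut_homM !reflectsE.
  by case: (reflects g) (reflects f) => [] []; rewrite /= ?opprK.
have nid a : reflects a -> exists x : Zmod m, (- x)%R != x.
  by move=> ra; have /existsP[x] := ra; rewrite reflectsE ra; exists x.
case E: (reflects g (+) reflects f).
  have [x xP] : exists x : Zmod m, (- x)%R != x.
    by case: (boolP (reflects g)) E => [/nid //|_ /= /nid].
  by apply/existsP; exists x; rewrite gfE E.
by apply/existsP => -[x]; rewrite gfE E eqxx.
Qed.

Lemma residue_hpart_inj u v :
  residue u = residue v -> hpart u = hpart v -> u = v.
Proof.
by case: u v => [[x g]] [[z f]]; rewrite /residue /hpart /= => -> ->.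
Qed.

Lemma residueM u v : residue (u * v)%g =
  residue u + (if reflects (hpart u) then - residue v else residue v).
Proof.
case: u v => [[x g]] [[z f]]; rewrite -(reflectsE g z).
by [].
Qed.

Lemma hpartM u v : hpart (u * v)%g = (hpart u * hpart v)%g.
Proof. by case: u v => [[x g]] [[z f]]. Qed.

Lemma sd_prodE (s : seq (semidirect phi)) :
  residue (\prod_(u <- s) u)%g = walk residue (reflects \o hpart) false s /\
  hpart (\prod_(u <- s) u)%g = (\prod_(u <- s) hpart u)%g.
Proof.
elim: s => [|u s [IHx IHh]]; first by rewrite !big_nil.
rewrite !big_cons residueM hpartM IHx IHh; split=> //=; congr (_ + _).
by case: (reflects _) => //; rewrite -[true]/(~~ false) walk_negb.
Qed.

End Semidirect.

Theorem theorem3p4 (m k : nat) (H : finGroupType) (phi : aut_hom H (Zmod m))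
    (S : {set semidirect phi}) :
  (1 <= m)%N -> (1 <= k)%N ->
  abelian [set: H] -> strongly_sequenceable H ->
  id_or_opp phi ->
  (forall p : nat, prime p -> (p %| m)%N -> (k`! < p)%N) ->
  1%g \notin S -> #|S| = k ->
  sequenceable S.
Proof.
move=> m0 _ cH sH phiP mP S1 cS.
have [|y yP] := @rational_walk_model _ S m.-1.+1
    (fun u => (residue u : nat)%:Z) (ltn0Sn _).
  by rewrite cS prednK.
pose h := @hpart m H phi; pose r := reflects phi \o h.
have y_eq0 q b s : uniq s -> {subset s <= S} ->
    (walk (@residue m H phi) q b s == 0) = (walk y q b s == 0).
  by move=> us sS; rewrite walk_Zp_eq0 yP.
have injS : {in enum S &, forall u v, y u = y v -> h u = h v -> u = v}.
  move=> u v; rewrite !mem_enum => uS vS yuv huv.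
  apply/eqP; apply: contraT => uv.
  have := y_eq0 predT false [:: u; v].
  rewrite /= !inE uv !addr0 yuv subrr eqxx subr_eq0 => /(_ isT) E.
  case/negP: uv; apply/eqP; apply: residue_hpart_inj => //; apply/eqP; apply: E.
  by move=> w; rewrite !inE => /orP[] /eqP->.
have hS : {in enum S, forall u, y u = 0 -> h u != 1%g}.
  move=> u; rewrite mem_enum => uS yu; apply: contra S1 => /eqP hu.
  have := y_eq0 predT false [:: u] isT.
  rewrite /= !addr0 yu eqxx => E; suff <- : u = 1%g by [].
  apply: residue_hpart_inj => //; apply/eqP; apply: E.
  by move=> w; rewrite inE => /eqP->.
have [t pt tP] : exists2 t, perm_eq t (enum S) &
    no_proper_block (zero_block h y r) t.
  case: (boolP (has r (enum S))) => rS.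
    apply: reflections_sequence => //; [exact: reflectsM|exact: enum_uniq].
  by apply: translations_sequence => //; exact: enum_uniq.
exists t; split=> //; apply/no_proper_blockP.
move=> a b c et b0 b1; apply: (tP a b c et b0).
have := sd_prodE phiP b; rewrite b1 => -[/esym wb /esym hb]; split=> //.
apply/eqP; rewrite -y_eq0 ?wb //.
  have : uniq t by rewrite (perm_uniq pt) enum_uniq.
  by rewrite et !cat_uniq => /and3P[_ _ /and3P[]].
by move=> u ub; rewrite -mem_enum -(perm_mem pt) et !mem_cat ub orbT.
Qed.
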